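(* Let $n$ be a positive integer and let $\mathbb{F}$ be a field with $\operatorname{char}(\mathbb{F})\neq 2$ and $|\mathbb{F}|\geq n^2+1$. Let $\Sigma_n$ denote the set of all $n\times n$ symmetric matrices over $\mathbb{F}$ and $M_n$ the set of all $n\times n$ matrices over $\mathbb{F}$. Let $\phi,\psi:\Sigma_n\to\Sigma_n$ be maps, at least one of which is surjective, satisfying $$\det(\phi(x)+\psi(y))=\det(x+y)\qquad\text{for all } x,y\in\Sigma_n.$$ Then there exist $x_0\in\Sigma_n$, $u\in M_n$ and $\beta\in\mathbb{F}$ with $\det(\beta u^2)=1$ such that $$\phi(x)=\beta u(x+x_0)u^t\quad\text{and}\quad \psi(x)=\beta u(x-x_0)u^t\qquad\text{for all } x\in\Sigma_n.$$
   Context: $u^t$ denotes the transpose of $u$, and $\beta u^2$ is the scalar $\beta$ times the matrix $u^2=uu$. *)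

(* Defs.v *)
From mathcomp Require Import all_boot all_order all_algebra.
Set Implicit Arguments. Unset Strict Implicit. Unset Printing Implicit Defensive.
Import GRing.Theory.
Local Open Scope ring_scope.

Definition symmetric_mx (F : fieldType) (n : nat) (A : 'M[F]_n) : Prop := A^T = A.

Definition card_at_least (F : fieldType) (k : nat) : Prop :=
  exists s : seq F, uniq s /\ size s = k.

Definition surj_on_sym (F : fieldType) (n : nat) (f : 'M[F]_n -> 'M[F]_n) : Prop :=
  forall y, symmetric_mx y -> exists2 x, symmetric_mx x & f x = y.

(* Main.v *)
(* Assume psi is surjective. For fixed y, det(x + s v v^t + y) is affine in s, and a symmetric matrix A is
   determined by the function z |-> det(z + A) on symmetric z; hence phi maps the line x + s v v^t affinely to
   a line whose direction P makes det(z + s P) affine in s, which forces rank P <= 1. If a mixed difference of phi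
   along v v^t and w w^t were nonzero, the rank bounds would make phi collapse points of that plane, contradicting
   injectivity. So phi is affine; its linear part K preserves det and maps squares to matrices of rank at most one.
   A congruence makes every K(E_ii) a multiple of E_ii; the trace pairing with diagonal matrices then gives the
   diagonal entries of K x, the rank bound gives the others, and K becomes the Hadamard product with the image of the
   all-ones matrix, which has rank one. *)
Require Import Defs.
From mathcomp Require Import all_boot all_order all_algebra.
From mathcomp Require Import ring.
Set Implicit Arguments.
Unset Strict Implicit.
Unset Printing Implicit Defensive.
Import GRing.Theory.
Local Open Scope ring_scope.

(** * Determinants of pencils and trace identities *)

Lemma poly_eq0_card (F : fieldType) (m : nat) (p : {poly F}) :
  card_at_least F m -> (size p <= m)%N -> (forall t, p.[t] = 0) -> p = 0.
Proof.
case=> s [us sz] hp h; apply: (@roots_geq_poly_eq0 _ p s) => //; last by rewrite sz.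
by apply/allP => t _; apply/eqP.
Qed.

(** For invertible [z] this is [det (t z + A)] as a polynomial in [t]; going through [char_poly]
    makes its coefficient of degree [n - 1] a trace. *)
Definition pencil (F : fieldType) (n : nat) (z A : 'M[F]_n) : {poly F} :=
  \det z *: char_poly (- (invmx z *m A)).

Lemma horner_pencil (F : fieldType) (n : nat) (z A : 'M[F]_n) (t : F) :
  z \in unitmx -> (pencil z A).[t] = \det (t *: z + A).
Proof.
move=> uz; rewrite hornerZ.
have -> : t *: z + A = z *m (t%:M + invmx z *m A).
  by rewrite mulmxDr mul_mx_scalar mulmxA mulmxV // mul1mx.
rewrite det_mulmx; congr (_ * _).
rewrite -horner_evalE -det_map_mx; congr (\det _).
apply/matrixP => i j; rewrite !mxE /= horner_evalE hornerD hornerN hornerC.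
by rewrite hornerMn hornerX opprK.
Qed.

Lemma size_pencil (F : fieldType) (n : nat) (z A : 'M[F]_n) :
  (size (pencil z A) <= n.+1)%N.
Proof. by rewrite (leq_trans (size_scale_leq _ _)) // size_char_poly. Qed.

Lemma coef_pencil (F : fieldType) (n : nat) (z A : 'M[F]_n) : (0 < n)%N ->
  (pencil z A)`_n.-1 = \det z * \tr (invmx z *m A).
Proof. by move=> n0; rewrite coefZ char_poly_trace // linearN /= opprK. Qed.

(** The combination of pencils has degree at most [n] and vanishes at [n + 1] scalars, so it is the
    zero polynomial; its coefficient of degree [n - 1] is the conclusion. *)
Lemma trace_relation (F : fieldType) (n : nat)
    (r : seq (F * 'M[F]_n * 'M[F]_n)) :
  (0 < n)%N -> card_at_least F n.+1 ->
  (forall a, a \in r -> a.1.2 \in unitmx) ->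
  (forall t, \sum_(a <- r) a.1.1 * \det (t *: a.1.2 + a.2) = 0) ->
  \sum_(a <- r) a.1.1 * (\det a.1.2 * \tr (invmx a.1.2 *m a.2)) = 0.
Proof.
move=> n0 cF ur h.
have p0 : \sum_(a <- r) a.1.1 *: pencil a.1.2 a.2 = 0.
  apply: (poly_eq0_card cF).
    apply: (leq_trans (size_sum _ _ _)); apply/bigmax_leqP_seq => a _ _.
    by rewrite (leq_trans (size_scale_leq _ _)) // size_pencil.
  move=> t; rewrite horner_sum -[RHS](h t) big_seq [RHS]big_seq.
  by apply: eq_bigr => a ar; rewrite hornerZ horner_pencil // ur.
have := congr1 (fun p : {poly F} => p`_n.-1) p0.
rewrite coef0 coef_sum => p1; rewrite -[RHS]p1.
by apply: eq_bigr => a _; rewrite coefZ coef_pencil.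
Qed.

(** * Symmetric matrices and the trace form on them *)

Lemma symmetric_mx_inv (F : fieldType) (n : nat) (z : 'M[F]_n) :
  symmetric_mx z -> symmetric_mx (invmx z).
Proof. by rewrite /symmetric_mx trmx_inv => ->. Qed.

Lemma symmetric_mx_scalar (F : fieldType) (n : nat) (a : F) :
  symmetric_mx (a%:M : 'M_n).
Proof. exact: tr_scalar_mx. Qed.

Lemma symmetric_mx0 (F : fieldType) (n : nat) : symmetric_mx (0 : 'M[F]_n).
Proof. exact: trmx0. Qed.

Lemma symmetric_mxD (F : fieldType) (n : nat) (x y : 'M[F]_n) :
  symmetric_mx x -> symmetric_mx y -> symmetric_mx (x + y).
Proof. by rewrite /symmetric_mx linearD /= => -> ->. Qed.

Lemma symmetric_mxZ (F : fieldType) (n : nat) (a : F) (x : 'M[F]_n) :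
  symmetric_mx x -> symmetric_mx (a *: x).
Proof. by rewrite /symmetric_mx linearZ /= => ->. Qed.

Lemma symmetric_mxB (F : fieldType) (n : nat) (x y : 'M[F]_n) :
  symmetric_mx x -> symmetric_mx y -> symmetric_mx (x - y).
Proof. by rewrite /symmetric_mx linearB /= => -> ->. Qed.

Lemma symmetric_mx_congr (F : fieldType) (n : nat) (q x : 'M[F]_n) :
  symmetric_mx x -> symmetric_mx (q *m x *m q^T).
Proof. by rewrite /symmetric_mx !trmx_mul trmxK mulmxA => ->. Qed.

Lemma symmetric_mx_sum (F : fieldType) (n : nat) (T : Type) (r : seq T)
    (f : T -> 'M[F]_n) :
  (forall a, symmetric_mx (f a)) -> symmetric_mx (\sum_(a <- r) f a).
Proof.
by move=> h; rewrite /symmetric_mx linear_sum; apply: eq_bigr => a _; apply: h.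
Qed.

(** A bad [a] is a root of the characteristic polynomial of [- w], which has at most [n] roots. *)
Lemma exists_unit_shift (F : fieldType) (n : nat) (w : 'M[F]_n) :
  card_at_least F n.+1 -> exists a, w + a%:M \in unitmx.
Proof.
move=> [s [us ss]].
have sz : size (char_poly (- w)) = n.+1 by rewrite size_char_poly.
have nz : char_poly (- w) != 0 by rewrite -size_poly_eq0 sz.
have /allPn [a _ na] : ~~ all (root (char_poly (- w))) s.
  by apply/negP => hr; have := max_poly_roots nz hr us; rewrite sz ss ltnn.
exists a; rewrite unitmxE unitfE; apply: contra na => /eqP d0.
rewrite rootE -horner_evalE -det_map_mx -d0; apply/eqP; congr (\det _).
apply/matrixP => i j; rewrite !mxE /= horner_evalE hornerD hornerN hornerC.
by rewrite hornerMn hornerX opprK addrC.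
Qed.

Lemma symmetric_trace_nondeg (F : fieldType) (n : nat) (E : 'M[F]_n) :
  (2 : F) != 0 -> symmetric_mx E ->
  (forall w, symmetric_mx w -> \tr (w *m E) = 0) -> E = 0.
Proof.
move=> two sE h; apply/matrixP => i j; rewrite mxE.
have Eij : E j i = E i j by rewrite -[in RHS]sE mxE.
have := h (delta_mx i j + delta_mx j i).
rewrite /symmetric_mx linearD /= !trmx_delta addrC => /(_ erefl).
have trd k l : \tr (delta_mx k l *m E) = E l k.
  rewrite /mxtrace (bigD1 k) //= big1 => [|m mk].
    by rewrite addr0 mxE (bigD1 l) //= mxE !eqxx mul1r big1 ?addr0 // => m ml;
       rewrite mxE (negPf ml) andbF mul0r.
  by rewrite mxE big1 // => p _; rewrite mxE (negPf mk) mul0r.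
rewrite mulmxDl linearD /= !trd Eij => e.
have : 2 * E i j = 0 by rewrite -[RHS]e; ring.
by move=> /eqP; rewrite mulf_eq0 (negPf two) /= => /eqP.
Qed.

(** Taking [z = t w^-1] in the hypothesis, [trace_relation] shows that the weighted sum [E] is
    trace-orthogonal to every invertible symmetric [w]. Shifting by scalar matrices extends this to
    all symmetric [w], and the trace form is nondegenerate. *)
Lemma det_relation_linear (F : fieldType) (n : nat) (r : seq (F * 'M[F]_n)) :
  (0 < n)%N -> card_at_least F n.+1 -> (2 : F) != 0 ->
  (forall a, a \in r -> symmetric_mx a.2) ->
  (forall z, symmetric_mx z -> \sum_(a <- r) a.1 * \det (z + a.2) = 0) ->
  \sum_(a <- r) a.1 *: a.2 = 0.
Proof.
move=> n0 cF two sr h; set E := \sum_(a <- r) _.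
have sE : symmetric_mx E.
  rewrite /symmetric_mx /E linear_sum big_seq [RHS]big_seq.
  by apply: eq_bigr => a /sr sa; rewrite linearZ /= sa.
have tu w : w \in unitmx -> symmetric_mx w -> \tr (w *m E) = 0.
  move=> uw sw.
  have := @trace_relation F n [seq (a.1, invmx w, a.2) | a <- r] n0 cF.
  rewrite big_map /= => H.
  have {H} : \sum_(a <- r) a.1 * (\det (invmx w) * \tr (invmx (invmx w) *m a.2)) = 0.
    apply: H => [a /mapP [b _ ->] /=|t]; first by rewrite unitmx_inv.
    rewrite big_map /=; apply: h.
    by apply: symmetric_mxZ; apply: symmetric_mx_inv.
  rewrite invmxK => H.
  have dw : \det (invmx w) != 0 by rewrite -unitfE -unitmxE unitmx_inv.
  apply: (mulfI dw); rewrite mulr0 -[RHS]H mulmx_sumr linear_sum mulr_sumr.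
  apply: eq_bigr => a _; rewrite -scalemxAr linearZ /=; ring.
apply: symmetric_trace_nondeg => // w sw.
have [a ua] := @exists_unit_shift F n w cF.
have := tu _ ua (symmetric_mxD sw (symmetric_mx_scalar n a)).
rewrite mulmxDl linearD /= mul_scalar_mx linearZ /=.
have := tu 1%:M (unitmx1 _ _) (symmetric_mx_scalar n 1).
by rewrite mul1mx => ->; rewrite mulr0 addr0.
Qed.

(** * Rank-one directions and determinants affine along them *)

Definition sq_mx (F : fieldType) (n : nat) (v : 'cV[F]_n) : 'M[F]_n := v *m v^T.

Lemma sq_mxE (F : fieldType) (n : nat) (v : 'cV[F]_n) i j :
  sq_mx v i j = v i 0 * v j 0.
Proof. by rewrite mxE big_ord1 mxE. Qed.

Lemma symmetric_sq_mx (F : fieldType) (n : nat) (v : 'cV[F]_n) :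
  symmetric_mx (sq_mx v).
Proof. by rewrite /symmetric_mx trmx_mul trmxK. Qed.

Lemma det_add_rank1_affine (F : fieldType) (n : nat) (z : 'M[F]_n)
    (v : 'cV[F]_n) (s : F) :
  \det (z + s *: sq_mx v) = (1 - s) * \det z + s * \det (z + sq_mx v).
Proof.
(* Bordering the matrix confines [t] to the first row, in which the determinant is linear. *)
have E t : \det (z + t *: sq_mx v) = \det (block_mx 1%:M (- t *: v^T) v z).
  have -> : block_mx 1%:M (- t *: v^T) v z =
      block_mx 1%:M 0 v 1%:M *m block_mx 1%:M (- t *: v^T) 0 (z + t *: sq_mx v).
    rewrite mulmx_block !mul1mx !mulmx0 !mul0mx !addr0 mulmx1.
    congr block_mx.
    by rewrite -scalemxAr scaleNr -/(sq_mx v) addrCA addNr addr0.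
  by rewrite det_mulmx det_lblock det_ublock !det1 !mul1r.
have -> : \det z = \det (z + 0 *: sq_mx v) by rewrite scale0r addr0.
have -> : \det (z + sq_mx v) = \det (z + 1 *: sq_mx v) by rewrite scale1r.
rewrite !E; apply: (@determinant_multilinear _ _ _ _ _ (lshift n ord0)).
- apply/rowP => j; rewrite !mxE !(unsplitK (inl _)) !mxE.
  case: (split j) => k; rewrite !mxE; ring.
- apply/matrixP => i j; rewrite !mxE.
  have -> : lift (lshift n ord0) i = rshift 1 i by apply: val_inj.
  by rewrite !(unsplitK (inr _)) !mxE.
- apply/matrixP => i j; rewrite !mxE.
  have -> : lift (lshift n ord0) i = rshift 1 i by apply: val_inj.
  by rewrite !(unsplitK (inr _)) !mxE.
Qed.

Definition det_affine_along (F : fieldType) (n : nat) (P : 'M[F]_n) : Prop :=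
  forall z s, symmetric_mx z ->
    \det (z + s *: P) = (1 - s) * \det z + s * \det (z + P).

(* Together with symmetry, this says that P has rank at most one. *)
Definition proportional_cols (F : fieldType) (n : nat) (P : 'M[F]_n) : Prop :=
  forall i k l, P i i * P k l = P i k * P i l.

Lemma det_affine_along_congr (F : fieldType) (n : nat) (q P : 'M[F]_n) :
  q \in unitmx -> det_affine_along P -> det_affine_along (q *m P *m q^T).
Proof.
move=> uq h z s sz; have uqt : q^T \in unitmx by rewrite unitmx_tr.
have E t : \det (z + t *: (q *m P *m q^T)) =
    \det q * \det (invmx q *m z *m (invmx q)^T + t *: P) * \det q^T.
  rewrite -!det_mulmx mulmxDr mulmxDl !mulmxA mulmxV // mul1mx trmx_inv.
  by rewrite mulmxKV // -scalemxAr -scalemxAl.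
have /h H : symmetric_mx (invmx q *m z *m (invmx q)^T) by apply: symmetric_mx_congr.
have -> : \det z = \det (z + 0 *: (q *m P *m q^T)) by rewrite scale0r addr0.
have -> : \det (z + q *m P *m q^T) = \det (z + 1 *: (q *m P *m q^T)).
  by rewrite scale1r.
rewrite !E [in LHS]H scale0r addr0 scale1r; ring.
Qed.

Lemma size_det_pencil (F : fieldType) (n : nat) (D P : 'M[F]_n) :
  (size (\det (\matrix_(k, l) ((D k l)%:P + 'X * (P k l)%:P)))%R <= n.+1)%N.
Proof.
apply: (leq_trans (size_sum _ _ _)); apply/bigmax_leqP => s _.
rewrite size_Msign; apply: (leq_trans (size_poly_prod_leq _ _)).
rewrite cardT size_enum_ord leq_subLR.
have : (\sum_(i < n) size ((\matrix_(k, l) ((D k l)%:P + 'X * (P k l)%:P))%R i (perm.fun_of_perm s i)) <= \sum_(i < n) 2)%N.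
  apply: leq_sum => i _; rewrite mxE; apply: (leq_trans (size_polyD _ _)).
  rewrite geq_max (leq_trans (size_polyC_leq1 _)) //=.
  apply: (leq_trans (size_polyMleq _ _)); rewrite size_polyX.
  by apply: size_polyC_leq1.
by rewrite sum_nat_const card_ord muln2 -addnn addnS ltnS.
Qed.

(* Apply affinity to det(D + X P), where D is the identity with zeros at places i and j: the coefficient of X^2 is the minor of P on i, j. *)
Lemma det_affine_minor (F : fieldType) (n : nat) (P : 'M[F]_n) (i j : 'I_n) :
  card_at_least F n.+1 -> i != j -> det_affine_along P ->
  P i i * P j j = P i j * P j i.
Proof.
move=> cF ij h.
pose e k := (k == i) || (k == j).
pose D : 'M[F]_n := \matrix_(k, l) ((k == l) && ~~ e k)%:R.
have sD : symmetric_mx D.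
  by apply/matrixP => k l; rewrite !mxE; case: (eqVneq l k) => [->|//].
pose A : 'M[{poly F}]_n := \matrix_(k, l) ((D k l)%:P + 'X * (P k l)%:P).
(* Rows [i] and [j] of [A] are divisible by ['X]; [B] is what remains after taking these two factors
   out. *)
pose B : 'M[{poly F}]_n :=
  \matrix_(k, l) (if e k then (P k l)%:P else ((k == l)%:R)%:P + 'X * (P k l)%:P).
pose d : 'rV[{poly F}]_n := \row_k (if e k then 'X else 1).
have n1 : (1 < n)%N.
  rewrite ltnNge; apply: contra ij => n1; rewrite -val_eqE /=.
  have := leq_trans (ltn_ord i) n1; have := leq_trans (ltn_ord j) n1.
  by rewrite !ltnS !leqn0 => /eqP -> /eqP ->.
have AB : A = diag_mx d *m B.
  rewrite mul_diag_mx; apply/matrixP => k l; rewrite !mxE.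
  case: (e k); first by rewrite andbF add0r.
  by rewrite andbT mul1r.
have dA : \det A = 'X ^+ 2 * \det B.
  rewrite AB det_mulmx det_diag; congr (_ * _).
  rewrite (bigD1 i) //= (bigD1 j) 1?eq_sym //= big1 => [|k /andP [ki kj]].
    by rewrite !mxE /e !eqxx orbT mulr1.
  by rewrite mxE /e (negPf ki) (negPf kj).
have hA t : (\det A).[t] = \det (D + t *: P).
  rewrite -horner_evalE -det_map_mx; congr (\det _); apply/matrixP => k l.
  by rewrite !mxE /= horner_evalE !hornerE.
have p0 : \det A - (((\det D)%:P : {poly F}) + (\det (D + P) - \det D)%:P * 'X) = 0.
  apply: (poly_eq0_card cF) => [|t].
    apply: (leq_trans (size_polyD _ _)); rewrite geq_max size_det_pencil size_polyN.
    apply: (leq_trans (size_polyD _ _)); rewrite geq_max.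
    rewrite (leq_trans (size_polyC_leq1 _)) //=.
    apply: (leq_trans (size_polyMleq _ _)); rewrite size_polyX addn2 /=.
    by rewrite ltnS (leq_trans (size_polyC_leq1 _)) // ltnW.
  by rewrite hornerD hornerN hA h // !hornerE; ring.
(* This is the coefficient of ['X^2] in [det A], and [p0] says that [det A] has degree at most 1. *)
have B0 : \det (map_mx (horner_eval 0) B) = 0.
  rewrite det_map_mx /= horner_evalE horner_coef0.
  have := congr1 (fun p : {poly F} => p`_2) p0.
  rewrite dA mulrC !(coefD, coefN, coefMXn, coefC, coefMX, coef0) /=.
  by rewrite addr0 oppr0 addr0.
(* Rather than expanding this determinant, take a kernel vector: it is supported on [i], [j] and
   solves the 2 by 2 system of [P] there, so by Cramer's rule the minor vanishes. *)
have /det0P [v v0 vB] : \det (map_mx (horner_eval 0) B)^T == 0 by rewrite det_tr B0.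
have Bv k : \sum_l v 0 l * (if e k then P k l else (k == l)%:R) = 0.
  have := congr1 (fun w : 'rV_n => w 0 k) vB; rewrite !mxE => H; rewrite -[RHS]H.
  apply: eq_bigr => l _; rewrite !mxE /= /horner_eval; congr (_ * _).
  by case: (e k); rewrite !hornerE.
have vk k : ~~ e k -> v 0 k = 0.
  move=> ek; have := Bv k; rewrite (negPf ek) (bigD1 k) //= eqxx mulr1.
  by rewrite big1 ?addr0 // => l; rewrite eq_sym => /negPf ->; rewrite mulr0.
have two k : e k -> v 0 i * P k i + v 0 j * P k j = 0.
  move=> ek; have := Bv k; rewrite ek (bigD1 i) //= (bigD1 j) 1?eq_sym //=.
  rewrite big1 ?addr0 // => l /andP [li lj].
  by rewrite vk ?mul0r // /e negb_or li.
have ei := two i; have ej := two j.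
rewrite /e !eqxx orbT /= in ei ej; have {}ei := ei isT; have {}ej := ej isT.
apply/eqP; rewrite -subr_eq0.
have di : v 0 i * (P i i * P j j - P i j * P j i) = 0.
  transitivity ((v 0 i * P i i + v 0 j * P i j) * P j j
     - (v 0 i * P j i + v 0 j * P j j) * P i j); first by ring.
  by rewrite ei ej !mul0r subrr.
have dj : v 0 j * (P i i * P j j - P i j * P j i) = 0.
  transitivity ((v 0 i * P j i + v 0 j * P j j) * P i i
     - (v 0 i * P i i + v 0 j * P i j) * P j i); first by ring.
  by rewrite ei ej !mul0r subrr.
apply/negPn; apply: contra v0 => nz.
apply/eqP/rowP => k; rewrite mxE.
have [ek|/vk //] := boolP (e k).
move: di dj => /eqP; rewrite mulf_eq0 (negPf nz) orbF => /eqP di.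
move=> /eqP; rewrite mulf_eq0 (negPf nz) orbF => /eqP dj.
by move: ek => /orP [] /eqP ->.
Qed.

(** For fixed [i] the relation is a symmetric bilinear one in [k] and [l]; its case [k = l] is a
    vanishing principal minor, and polarisation gives the rest. *)
Lemma det_affine_proportional (F : fieldType) (n : nat) (P : 'M[F]_n) :
  card_at_least F n.+1 -> (2 : F) != 0 -> symmetric_mx P ->
  det_affine_along P -> proportional_cols P.
Proof.
move=> cF two sP h i k l.
have Pt a b : P a b = P b a by rewrite -[in LHS]sP mxE.
have mn (Q : 'M[F]_n) a b : symmetric_mx Q -> det_affine_along Q -> Q a a * Q b b = Q a b * Q a b.
  move=> sQ hQ; have [->//|ab] := eqVneq a b.
  by rewrite (det_affine_minor cF ab hQ) -[in Q b a]sQ mxE.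
have [->|kl] := eqVneq k l; first exact: mn.
have [->|ki] := eqVneq k i; first by [].
have [->|li] := eqVneq l i; first by rewrite mulrC (Pt k).
(* Congruence by q adds row l to row k and column l to column k: this polarises the diagonal minors. *)
pose q : 'M[F]_n := 1%:M + delta_mx k l.
have qE a b : (q *m P *m q^T) a b =
    P a b + (a == k)%:R * P l b + (b == k)%:R * (P a l + (a == k)%:R * P l l).
  have dE (M : 'M[F]_n) c e : (delta_mx k l *m M) c e = (c == k)%:R * M l e.
    rewrite mxE (bigD1 l) //= mxE eqxx andbT big1 ?addr0 // => m ml.
    by rewrite mxE (negPf ml) andbF mul0r.
  have dE' (M : 'M[F]_n) c e : (M *m delta_mx l k) c e = (e == k)%:R * M c l.
    rewrite mxE (bigD1 l) //= mxE eqxx /= big1 ?addr0 1?mulrC // => m ml.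
    by rewrite mxE (negPf ml) mulr0.
  rewrite /q linearD /= trmx1 trmx_delta mulmxDl mul1mx mulmxDr mulmx1.
  have addE (M N : 'M[F]_n) c e : (M + N) c e = M c e + N c e by rewrite mxE.
  by rewrite !(addE, dE', dE).
have uq : q \in unitmx.
  have /mulmx1_unit [] // : q *m (1%:M - delta_mx k l) = 1%:M.
  rewrite mulmxBr mulmx1 mulmxDl mul1mx mul_delta_mx_0 1?eq_sym //.
  by rewrite addr0 addrK.
have := mn _ i k (@symmetric_mx_congr F n q P sP) (det_affine_along_congr uq h).
rewrite !qE eqxx eq_sym (negPf ki) !mul0r !addr0 !mul1r.
have := mn _ i k sP h; have := mn _ i l sP h.
rewrite (Pt l k) => el ek e.
apply: (mulfI two).
transitivity (P i i * (P k k + P k l + (P k l + P l l)) - P i i * P l l - P i i * P k k).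
  by ring.
by rewrite e el ek; ring.
Qed.

(** The rank condition at [B + t M] is quadratic in [t]. Its validity at 0, 1 and -1 makes every
    coefficient vanish: the quadratic one is [hM], the linear one is [cr]. *)
Lemma proportional_cols_pencil (F : fieldType) (n : nat) (B M : 'M[F]_n) :
  (2 : F) != 0 -> symmetric_mx B -> symmetric_mx M -> M != 0 ->
  proportional_cols B -> proportional_cols (B + M) -> proportional_cols (B - M) ->
  exists b, B = b *: M.
Proof.
move=> two sB sM M0 hB hp hm.
have Bt a b : B a b = B b a by rewrite -[in LHS]sB mxE.
have Mt a b : M a b = M b a by rewrite -[in LHS]sM mxE.
have hM : proportional_cols M.
  move=> i k l; apply: (mulfI two).
  have := hp i k l; have := hm i k l; have := hB i k l; rewrite !mxE => e0 em ep.
  transitivity ((B i i + M i i) * (B k l + M k l) + (B i i - M i i) * (B k l - M k l)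
     - 2 * (B i i * B k l)); first by ring.
  by rewrite ep em e0; ring.
have cr i k l : B i i * M k l + M i i * B k l = B i k * M i l + M i k * B i l.
  have := hp i k l; have := hB i k l; have := hM i k l; rewrite !mxE => e0 em ep.
  transitivity ((B i i + M i i) * (B k l + M k l) - B i i * B k l - M i i * M k l).
    by ring.
  by rewrite ep em e0; ring.
(* With a zero diagonal, [hM] would make the square of every entry vanish. *)
have [i Mi] : exists i, M i i != 0.
  apply/existsP; apply: contraNT M0; rewrite negb_exists => /forallP d0.
  apply/eqP/matrixP => k l; rewrite mxE.
  have := hM k l l; move: (d0 k) => /= /negPn /eqP ->.
  by rewrite mul0r => /esym /eqP; rewrite mulf_eq0 orbb => /eqP.
pose b := B i i / M i i.
(* By [cr], [hM] and [hB] at [(i, k, k)], the square of [M i i * B i k - B i i * M i k] is zero. *)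
have Bi k : B i k = b * M i k.
  apply: (mulfI Mi); have -> : M i i * (b * M i k) = B i i * M i k.
    by rewrite /b; field.
  apply/eqP; rewrite -subr_eq0 -[_ == 0]orbb -mulf_eq0; apply/eqP.
  have e1 := cr i k k; have e2 := hM i k k; have e3 := hB i k k.
  transitivity (M i i * M i i * (B i k * B i k) + B i i * B i i * (M i k * M i k)
     - B i i * M i i * (B i k * M i k + M i k * B i k)); first by ring.
  by rewrite -e1 -e2 -e3; ring.
exists b; apply/matrixP => k l; rewrite mxE; apply: (mulfI Mi).
have e1 := cr i k l; have e2 := hM i k l.
transitivity (B i i * M k l + M i i * B k l - B i i * M k l); first by ring.
rewrite e1 !Bi.
transitivity (2 * b * (M i k * M i l) - b * M i i * M k l); first by ring.
by rewrite -e2; ring.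
Qed.

(** * Generating symmetric matrices by squares *)

Definition basis_sum (F : fieldType) (n : nat) (i j : 'I_n) : 'cV[F]_n :=
  delta_mx i 0 + delta_mx j 0.

(** Each bracket is [E_ij + E_ji]; summing over ordered pairs counts every entry twice, hence the
    division by 2. *)
Lemma symmetric_mx_decomp (F : fieldType) (n : nat) (x : 'M[F]_n) :
  (2 : F) != 0 -> symmetric_mx x ->
  x = \sum_i \sum_j (x i j / 2) *: (sq_mx (basis_sum F i j)
        - sq_mx (delta_mx i 0) - sq_mx (delta_mx j 0)).
Proof.
move=> two sx.
have E i j : sq_mx (basis_sum F i j) - sq_mx (delta_mx i 0) - sq_mx (delta_mx j 0)
    = delta_mx i j + delta_mx j i :> 'M[F]_n.
  rewrite /sq_mx /basis_sum linearD /= !trmx_delta mulmxDl !mulmxDr.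
  by rewrite !mul_delta_mx; apply/matrixP => k l; rewrite !mxE; ring.
transitivity (\sum_i \sum_j ((x i j / 2) *: delta_mx i j
    + (x i j / 2) *: (delta_mx j i : 'M[F]_n))); last first.
  by apply: eq_bigr => i _; apply: eq_bigr => j _; rewrite E scalerDr.
under eq_bigr => i _ do rewrite big_split /=.
rewrite big_split /= [X in _ + X]exchange_big /=.
rewrite [LHS]matrix_sum_delta -big_split; apply: eq_bigr => i _ /=.
rewrite -big_split; apply: eq_bigr => j _ /=.
have -> : x j i = x i j by rewrite -[in LHS]sx mxE.
by rewrite -scalerDl; congr (_ *: _); field.
Qed.

Lemma symmetric_mx_ind (F : fieldType) (n : nat) (Q : 'M[F]_n -> Prop) :
  (2 : F) != 0 -> Q 0 ->
  (forall x s v, symmetric_mx x -> Q x -> Q (x + s *: sq_mx v)) ->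
  forall x, symmetric_mx x -> Q x.
Proof.
move=> two Q0 QS x sx.
(* Preservation of [Q] under translation by [y] is closed under sums, which [Q] itself need not
   be. *)
pose R y := symmetric_mx y /\ forall x, symmetric_mx x -> Q x -> Q (x + y).
suff [_ h] : R x by rewrite -[x]add0r; apply: h => //; apply: symmetric_mx0.
have R0 : R 0 by split=> [|y _]; rewrite ?addr0 //; apply: symmetric_mx0.
have RD y z : R y -> R z -> R (y + z).
  move=> [sy hy] [sz hz]; split; first exact: symmetric_mxD.
  move=> t st Qt; rewrite addrA; apply: hz; last exact: hy.
  exact: symmetric_mxD.
have RS s v : R (s *: sq_mx v).
  split=> [|t st Qt]; first by apply: symmetric_mxZ; apply: symmetric_sq_mx.
  exact: QS.
rewrite (symmetric_mx_decomp two sx).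
apply: big_ind => // i _; apply: big_ind => // j _.
by rewrite !scalerBr -!scaleNr; apply: (RD); [apply: (RD)|].
Qed.

Lemma det_translation_inj (F : fieldType) (n : nat) (x y : 'M[F]_n) :
  (0 < n)%N -> card_at_least F n.+1 -> (2 : F) != 0 ->
  symmetric_mx x -> symmetric_mx y ->
  (forall z, symmetric_mx z -> \det (z + x) = \det (z + y)) -> x = y.
Proof.
move=> n0 cF two sx sy h.
have := @det_relation_linear F n [:: (1, x); (-1, y)] n0 cF two.
rewrite !big_cons big_nil /= addr0 scale1r scaleN1r => H.
apply/eqP; rewrite -subr_eq0; apply/eqP; apply: H => [a|z sz].
  by rewrite !inE => /orP [] /eqP ->.
by rewrite !big_cons big_nil /= h //; ring.
Qed.

(** * With [psi] surjective, [phi] is affine *)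

Section DetPair.
Variables (F : fieldType) (n : nat) (phi psi : 'M[F]_n -> 'M[F]_n).
Hypotheses (n0 : (0 < n)%N) (cF : card_at_least F n.+1) (two : (2 : F) != 0).
Hypotheses (sphi : forall x, symmetric_mx x -> symmetric_mx (phi x))
  (surj : surj_on_sym psi)
  (detE : forall x y, symmetric_mx x -> symmetric_mx y ->
     \det (phi x + psi y) = \det (x + y)).

Lemma det_pair_inj x y : symmetric_mx x -> symmetric_mx y -> phi x = phi y -> x = y.
Proof.
move=> sx sy e; apply: det_translation_inj => // z sz.
by rewrite ![z + _]addrC -(detE sx sz) -(detE sy sz) e.
Qed.

(** The affine dependence of [det (x + s v v^T + y)] on [s] is a linear relation between
    determinants of [phi(..) + psi y]. Surjectivity makes [psi y] arbitrary, so
    [det_relation_linear] transfers the relation to the values of [phi]. *)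
Lemma det_pair_line x v s : symmetric_mx x ->
  phi (x + s *: sq_mx v) = phi x + s *: (phi (x + sq_mx v) - phi x).
Proof.
move=> sx; have sv := symmetric_sq_mx v.
have sxv : symmetric_mx (x + sq_mx v) by apply: symmetric_mxD.
have sxs : symmetric_mx (x + s *: sq_mx v).
  by apply: symmetric_mxD => //; apply: symmetric_mxZ.
have := @det_relation_linear F n [:: (1, phi (x + s *: sq_mx v));
  (s - 1, phi x); (- s, phi (x + sq_mx v))] n0 cF two.
rewrite !big_cons big_nil /= => H.
apply/eqP; rewrite -subr_eq0 -[X in _ == X]H; last first.
- move=> z sz; have [y sy <-] := surj sz; rewrite !big_cons big_nil /=.
  rewrite ![psi y + _]addrC !detE // addrAC det_add_rank1_affine addrAC.
  by ring.
- by move=> a; rewrite !inE => /or3P [] /eqP -> /=; apply: sphi.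
by apply/eqP/matrixP => i j; rewrite !mxE; ring.
Qed.

(** Any symmetric [z] is [phi x + psi y] for some [y], so moving [z] along the step amounts to
    moving [x + y] along [v v^T], where the determinant is affine. *)
Lemma det_pair_step_proportional x v : symmetric_mx x ->
  proportional_cols (phi (x + sq_mx v) - phi x).
Proof.
move=> sx; have sv := symmetric_sq_mx v.
have sxv : symmetric_mx (x + sq_mx v) by apply: symmetric_mxD.
apply: det_affine_proportional => //; first by apply: symmetric_mxB; apply: sphi.
move=> z s sz; have : symmetric_mx (z - phi x) by apply: symmetric_mxB => //; apply: sphi.
move=> /surj [y sy ey].
have sxs : symmetric_mx (x + s *: sq_mx v).
  by apply: symmetric_mxD => //; apply: symmetric_mxZ.
have -> : z = phi x + psi y by rewrite ey addrC subrK.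
have -> : phi x + psi y + s *: (phi (x + sq_mx v) - phi x) = phi (x + s *: sq_mx v) + psi y.
  by rewrite det_pair_line // addrAC.
have -> : phi x + psi y + (phi (x + sq_mx v) - phi x) = phi (x + sq_mx v) + psi y.
  by apply/matrixP => i j; rewrite !mxE; ring.
rewrite !detE // [x + _ + y]addrAC det_add_rank1_affine.
by rewrite [x + sq_mx v + y]addrAC.
Qed.

(** Suppose the mixed difference [M] is nonzero. All steps [B + t M] and [C + t M] have rank at most
    one, so [B = b M] and [C = c M], and [phi] sends the whole plane through [x] into one line of
    direction [M], against injectivity. *)
Lemma det_pair_mixed_difference x v w : symmetric_mx x ->
  phi (x + sq_mx w + sq_mx v) - phi (x + sq_mx w) = phi (x + sq_mx v) - phi x.
Proof.
move=> sx; have sv := symmetric_sq_mx v; have sw := symmetric_sq_mx w.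
have sD := @symmetric_mxD F n; have sZ := @symmetric_mxZ F n.
pose B := phi (x + sq_mx v) - phi x; pose C := phi (x + sq_mx w) - phi x.
pose M := phi (x + sq_mx w + sq_mx v) - phi (x + sq_mx w) - B.
have sB : symmetric_mx B by apply: symmetric_mxB; apply: sphi => //; apply: (sD).
have sC : symmetric_mx C by apply: symmetric_mxB; apply: sphi => //; apply: (sD).
have sM : symmetric_mx M.
  by apply: symmetric_mxB => //; apply: symmetric_mxB; apply: sphi; do ?apply: (sD).
apply/eqP; rewrite -subr_eq0 -/B -/M; apply/negPn/negP => M0.
have MC : M = phi (x + sq_mx v + sq_mx w) - phi (x + sq_mx v) - C.
  by rewrite /M /B /C [x + sq_mx v + _]addrAC; apply/matrixP => i j; rewrite !mxE; ring.
have lineB t : phi (x + t *: sq_mx w + sq_mx v) - phi (x + t *: sq_mx w) = B + t *: M.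
  rewrite [x + _ + _]addrAC !det_pair_line //; last exact: sD.
  by rewrite MC /B /C; apply/matrixP => i j; rewrite !mxE; ring.
have lineC t : phi (x + t *: sq_mx v + sq_mx w) - phi (x + t *: sq_mx v) = C + t *: M.
  rewrite [x + _ + _]addrAC !det_pair_line //; last exact: sD.
  by rewrite /M /B /C; apply/matrixP => i j; rewrite !mxE; ring.
have pcB t : proportional_cols (B + t *: M).
  by rewrite -lineB; apply: det_pair_step_proportional; apply: (sD) => //; apply: (sZ).
have pcC t : proportional_cols (C + t *: M).
  by rewrite -lineC; apply: det_pair_step_proportional; apply: (sD) => //; apply: (sZ).
have [b Bb] : exists b, B = b *: M.
  have := pcB 0; have := pcB 1; have := pcB (-1).
  by rewrite scale0r scaleN1r scale1r addr0 => ? ? ?; apply: proportional_cols_pencil.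
have [c Cc] : exists c, C = c *: M.
  have := pcC 0; have := pcC 1; have := pcC (-1).
  by rewrite scale0r scaleN1r scale1r addr0 => ? ? ?; apply: proportional_cols_pencil.
(* phi is constant on the hyperbola b s + c t + s t = 0, so v v^T and w w^T are proportional. *)
have [s [s0 cs]] : exists s, s != 0 /\ c + s != 0.
  have [c1|c1] := eqVneq (c + 1) 0; last by exists 1; rewrite oner_neq0.
  exists 2; split=> //; have -> : c + 2 = (c + 1) + 1 by ring.
  by rewrite c1 add0r oner_neq0.
(* This solves [b s + c t + s t = 0]; one of [s = 1], [s = 2] keeps the denominator nonzero. *)
pose t := - (b * s) / (c + s).
have : phi (x + t *: sq_mx w + s *: sq_mx v) = phi x.
  rewrite det_pair_line; last by apply: (sD) => //; apply: (sZ).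
  rewrite lineB det_pair_line // -/C Bb Cc.
  transitivity (phi x + (t * c + s * (b + t)) *: M).
    by apply/matrixP => i j; rewrite !mxE; ring.
  have -> : t * c + s * (b + t) = 0 by rewrite /t; field.
  by rewrite scale0r addr0.
move=> /det_pair_inj; rewrite -addrA => /(_ _ sx) e.
have {}e : t *: sq_mx w + s *: sq_mx v = 0.
  have : x + (t *: sq_mx w + s *: sq_mx v) = x.
    by apply: e; apply: (sD) => //; apply: (sD); apply: (sZ).
  by rewrite -[in RHS](addr0 x) => /addrI.
have ev : sq_mx v = (- t / s) *: sq_mx w.
  apply: (scalerI s0); rewrite scalerA.
  have -> : s * (- t / s) = - t by field.
  by apply/eqP; rewrite scaleNr -subr_eq0 opprK addrC; apply/eqP.
move/negP: M0; apply; apply/eqP.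
(* The four points defining [M] now lie on one line of direction [w w^T], where [phi] is affine, so
   [M = 0]. *)
rewrite MC ev.
have -> : x + (- t / s) *: sq_mx w + sq_mx w = x + (- t / s + 1) *: sq_mx w.
  by rewrite scalerDl scale1r addrA.
rewrite !det_pair_line // -/C.
by apply/matrixP => i j; rewrite !mxE; ring.
Qed.

(** Since mixed differences vanish, the step of [phi] along a square does not depend on the base
    point; linearity then follows by adding multiples of squares one at a time. *)
Lemma det_pair_affine : exists K : 'M[F]_n -> 'M[F]_n,
  [/\ forall x, symmetric_mx x -> K x = phi x - phi 0,
      forall x y, symmetric_mx x -> symmetric_mx y -> K (x + y) = K x + K y &
      forall a x, symmetric_mx x -> K (a *: x) = a *: K x].
Proof.
have sD := @symmetric_mxD F n; have sZ := @symmetric_mxZ F n.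
have s0 := @symmetric_mx0 F n.
pose K x := phi x - phi 0.
have step v x : symmetric_mx x -> phi (x + sq_mx v) - phi x = phi (sq_mx v) - phi 0.
  move: x; apply: symmetric_mx_ind => //; first by rewrite add0r.
  move=> x s w sx <-.
  have e := @det_pair_mixed_difference x v w sx.
  have sxv : symmetric_mx (x + sq_mx v) by apply: (sD) => //; apply: symmetric_sq_mx.
  rewrite [x + s *: _ + _]addrAC !det_pair_line //.
  have -> : phi (x + sq_mx v + sq_mx w) = phi (x + sq_mx w) + (phi (x + sq_mx v) - phi x).
    by rewrite -e [x + sq_mx v + _]addrAC; apply/matrixP => i j; rewrite !mxE; ring.
  by apply/matrixP => i j; rewrite !mxE; ring.
have Kstep x s v : symmetric_mx x -> K (x + s *: sq_mx v) = K x + s *: K (sq_mx v).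
  by move=> sx; rewrite /K det_pair_line // step // addrAC.
exists K; split=> // [x y sx|a].
  move: y; apply: symmetric_mx_ind => //; first by rewrite addr0 [K 0]subrr addr0.
  by move=> y s v sy e; rewrite addrA !Kstep ?e ?addrA //; apply: (sD).
apply: symmetric_mx_ind => //; first by rewrite scaler0 [K 0]subrr scaler0.
by move=> y s v sy e; rewrite scalerDr scalerA !Kstep ?e ?scalerDr ?scalerA //; apply: (sZ).
Qed.
End DetPair.

(** * Linear determinant preservers on symmetric matrices *)

Lemma proportional_cols_sq (F : fieldType) (n : nat) (P : 'M[F]_n) :
  symmetric_mx P -> proportional_cols P -> exists c w, P = c *: sq_mx w.
Proof.
move=> sP h.
have Pt a b : P a b = P b a by rewrite -[in LHS]sP mxE.
have [/existsP [i Pi]|] := boolP [exists i, P i i != 0].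
  (* A nonzero pivot gives [P k l = P i k * P i l / P i i]; without any pivot, [P] is zero. *)
  exists (P i i)^-1, (col i P); apply/matrixP => k l; rewrite mxE sq_mxE !mxE.
  by apply: (mulfI Pi); rewrite mulVKf // h Pt [P l i]Pt.
rewrite negb_exists => /forallP d0; exists 0, 0; rewrite scale0r.
apply/matrixP => k l; rewrite mxE; have := h k l l.
move: (d0 k) => /negPn /eqP ->.
by rewrite mul0r => /esym /eqP; rewrite mulf_eq0 orbb => /eqP.
Qed.

Lemma trace_invmx_diag (F : fieldType) (n : nat) (e : 'rV[F]_n) (x : 'M[F]_n) :
  (forall i, e 0 i != 0) -> \tr (invmx (diag_mx e) *m x) = \sum_i x i i / e 0 i.
Proof.
move=> e0; pose f : 'rV[F]_n := \row_i (e 0 i)^-1.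
have ef : diag_mx e *m diag_mx f = 1%:M.
  rewrite mulmx_diag -diag_const_mx; congr diag_mx; apply/rowP => i.
  by rewrite !mxE mulfV.
have [ue _] := mulmx1_unit ef.
have -> : invmx (diag_mx e) = diag_mx f by rewrite -[RHS]mul1mx -(mulVmx ue) -mulmxA ef mulmx1.
by rewrite mul_diag_mx; apply: eq_bigr => i _; rewrite !mxE mulrC.
Qed.

Section LinearOnSym.
Variables (F : fieldType) (n : nat) (K : 'M[F]_n -> 'M[F]_n).
Hypotheses
  (KD : forall x y, symmetric_mx x -> symmetric_mx y -> K (x + y) = K x + K y)
  (KZ : forall a x, symmetric_mx x -> K (a *: x) = a *: K x).

Lemma lin_sym0 : K 0 = 0.
Proof. by rewrite -(scale0r (0 : 'M[F]_n)) KZ ?scale0r //; apply: symmetric_mx0. Qed.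

Lemma lin_sym_sum (T : Type) (r : seq T) (f : T -> 'M[F]_n) :
  (forall a, symmetric_mx (f a)) -> K (\sum_(a <- r) f a) = \sum_(a <- r) K (f a).
Proof.
move=> sf; elim: r => [|a r IH]; first by rewrite !big_nil lin_sym0.
by rewrite !big_cons KD ?IH //; apply: symmetric_mx_sum.
Qed.

Lemma lin_sym_diag (e l : 'rV[F]_n) :
  (forall i, K (sq_mx (delta_mx i 0)) = l 0 i *: sq_mx (delta_mx i 0)) ->
  K (diag_mx e) = diag_mx (\row_i (l 0 i * e 0 i)).
Proof.
move=> h.
have sqd (i : 'I_n) : sq_mx (delta_mx i 0) = delta_mx i i :> 'M[F]_n.
  by rewrite /sq_mx trmx_delta mul_delta_mx.
have D (g : 'rV[F]_n) : diag_mx g = \sum_i g 0 i *: sq_mx (delta_mx i 0).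
  by rewrite diag_mx_sum_delta; apply: eq_bigr => i _; rewrite sqd.
rewrite !D lin_sym_sum => [|i]; last by apply: symmetric_mxZ; apply: symmetric_sq_mx.
apply: eq_bigr => i _; rewrite KZ; last by apply: symmetric_sq_mx.
by rewrite h scalerA mxE mulrC.
Qed.
End LinearOnSym.

(** Each entry of [K x] turns out to depend only on the same entry of [x], so [K] is a Hadamard
    product; its multiplier is the image of the all-ones matrix, of rank at most one. The factor [d]
    absorbs the congruence used to reach this normal form. *)
Lemma det_preserver_diag_normal (F : fieldType) (n : nat) (K : 'M[F]_n -> 'M[F]_n)
    (d : F) (l : 'rV[F]_n) :
  (0 < n)%N -> card_at_least F n.+1 -> (2 : F) != 0 ->
  (forall x, symmetric_mx x -> symmetric_mx (K x)) ->
  (forall x y, symmetric_mx x -> symmetric_mx y -> K (x + y) = K x + K y) ->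
  (forall a x, symmetric_mx x -> K (a *: x) = a *: K x) ->
  (forall v, proportional_cols (K (sq_mx v))) ->
  d != 0 -> (forall x, symmetric_mx x -> \det (K x) = d * \det x) ->
  (forall i, K (sq_mx (delta_mx i 0)) = l 0 i *: sq_mx (delta_mx i 0)) ->
  exists c b, forall x, symmetric_mx x -> K x = c *: (diag_mx b *m x *m diag_mx b).
Proof.
move=> n0 cF two sK KD KZ pK d0 dK Kl.
have Kdiag e := lin_sym_diag KD KZ e Kl.
have sdiag (e : 'rV[F]_n) : symmetric_mx (diag_mx e) by apply: tr_diag_mx.
have l0 i : l 0 i != 0.
  have : \det (K (diag_mx (const_mx 1))) != 0.
    by rewrite dK // diag_const_mx det1 mulr1.
  by rewrite Kdiag det_diag => /prodf_neq0 /(_ i isT); rewrite !mxE mulr1.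
(* For [D = diag_mx e], the identity [det (t K D + K x) = d * det (t D + x)] is fed to
   [trace_relation] with weights [d] and [-1]. *)
have tr (e : 'rV[F]_n) x : (forall i, e 0 i != 0) -> symmetric_mx x ->
    \sum_i K x i i / (l 0 i * e 0 i) = \sum_i x i i / e 0 i.
  move=> e0 sx.
  have det_e : \det (diag_mx e) != 0.
    by rewrite det_diag; apply/prodf_neq0.
  have det_Ke : \det (K (diag_mx e)) = d * \det (diag_mx e) by apply: dK.
  have := @trace_relation F n [:: (d, diag_mx e, x); (-1, K (diag_mx e), K x)] n0 cF.
  rewrite !big_cons big_nil /= addr0 det_Ke => H.
  have {H} H : d * (\det (diag_mx e) * \tr (invmx (diag_mx e) *m x)) +
      -1 * (d * \det (diag_mx e) * \tr (invmx (K (diag_mx e)) *m K x)) = 0.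
    apply: H => [a|t].
      rewrite !inE => /orP [] /eqP -> /=; rewrite unitmxE unitfE //.
      by rewrite det_Ke mulf_neq0.
    rewrite !big_cons big_nil /= -KZ // -KD //; last exact: symmetric_mxZ.
    rewrite dK; first by ring.
    by apply: symmetric_mxD => //; apply: symmetric_mxZ.
  have {}H : (d * \det (diag_mx e)) * (\tr (invmx (diag_mx e) *m x) -
      \tr (invmx (K (diag_mx e)) *m K x)) = 0 by rewrite -[RHS]H; ring.
  move/eqP: H; rewrite mulf_eq0 (negPf (mulf_neq0 d0 det_e)) /= subr_eq0 => /eqP.
  rewrite Kdiag !trace_invmx_diag //; last by move=> i; rewrite mxE mulf_neq0.
  by move=> ->; apply: eq_bigr => i _; rewrite mxE.
(* The trace relation at D = 1 and at D = diag(1, .., 2, .., 1) isolates the i-th diagonal entry. *)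
have Kii x i : symmetric_mx x -> K x i i = l 0 i * x i i.
  move=> sx.
  pose e : 'rV[F]_n := \row_k (if k == i then 2 else 1).
  have := tr (const_mx 1) x; have := tr e x.
  have e0 k : e 0 k != 0 by rewrite mxE; case: (k == i); rewrite ?two ?oner_neq0.
  move=> /(_ e0 sx); rewrite (bigD1 i) //= [in RHS](bigD1 i) //= !mxE eqxx.
  under eq_bigr => k /negPf ki do rewrite mxE ki mulr1.
  under [in RHS]eq_bigr => k /negPf ki do rewrite mxE ki divr1.
  have o0 k : (const_mx 1 : 'rV[F]_n) 0 k != 0 by rewrite mxE oner_neq0.
  move=> e2 /(_ o0 sx); rewrite (bigD1 i) //= [in RHS](bigD1 i) //= !mxE.
  under eq_bigr => k _ do rewrite mxE mulr1.
  under [in RHS]eq_bigr => k _ do rewrite mxE divr1.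
  move=> e1.
  set S := \sum_(_ | _) _ in e1 e2; set T := \sum_(_ | _) _ in e1 e2.
  have li := l0 i.
  have E : K x i i / l 0 i / 2 = x i i / 2.
    transitivity ((K x i i / (l 0 i * 1) + S) - (K x i i / (l 0 i * 2) + S)).
      by field; rewrite ?two ?li.
    by rewrite e1 e2; field; rewrite two oner_neq0.
  have {}E : K x i i / l 0 i = x i i.
    by apply: (mulIf (invr_neq0 two)).
  by rewrite -[in RHS]E; field.
pose c k m := K (sq_mx (basis_sum F k m)) k m.
(* The rank bound equates the square of this entry with the product of two diagonal entries, which
   [Kii] evaluates to [l_k l_m (v_k v_m)^2]. *)
have zero (v : 'cV[F]_n) k m : k != m -> v k 0 * v m 0 = 0 -> K (sq_mx v) k m = 0.
  move=> km vkm; have sv := symmetric_sq_mx v.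
  have e := pK v k m m.
  move: e; rewrite !Kii // !sq_mxE => e.
  have {}e : K (sq_mx v) k m * K (sq_mx v) k m = 0.
    rewrite -e; transitivity (l 0 k * l 0 m * (v k 0 * v m 0) * (v k 0 * v m 0)).
      by ring.
    by rewrite vkm !mulr0.
  by move/eqP: e; rewrite mulf_eq0 orbb => /eqP.
(* In the decomposition of [x] into squares, only the pairs [(k, m)] and [(m, k)] could contribute
   to this entry, and their coefficient is zero. *)
have K0 x k m : symmetric_mx x -> k != m -> x k m = 0 -> K x k m = 0.
  move=> sx km xkm.
  have ssq (a : F) (v : 'cV[F]_n) : symmetric_mx (a *: sq_mx v).
    by apply: symmetric_mxZ; apply: symmetric_sq_mx.
  have sterm (i j : 'I_n) (a : F) : symmetric_mx (a *: (sq_mx (basis_sum F i j)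
      - sq_mx (delta_mx i 0) - sq_mx (delta_mx j 0))).
    rewrite !scalerBr; apply: symmetric_mxB; last exact: ssq.
    by apply: symmetric_mxB; apply: ssq.
  rewrite (symmetric_mx_decomp two sx) (lin_sym_sum KD KZ); last first.
    by move=> i; apply: symmetric_mx_sum => j; apply: sterm.
  rewrite summxE big1 // => i _.
  rewrite (lin_sym_sum KD KZ); last by move=> j; apply: sterm.
  rewrite summxE big1 // => j _.
  rewrite !scalerBr -!scaleNr !KD //; last exact: symmetric_mxD.
  rewrite !KZ; do ?exact: symmetric_sq_mx.
  have zd a : K (sq_mx (delta_mx a 0)) k m = 0.
    rewrite Kl mxE sq_mxE !mxE !eqxx !andbT; have [<-|_] := eqVneq k a.
      by rewrite eq_sym (negPf km) !mulr0.
    by rewrite mul0r mulr0.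
  rewrite !mxE !zd !mulr0 !addr0.
  have [/eqP e|ne] := boolP (basis_sum F i j k 0 * basis_sum F i j m 0 == 0).
    by rewrite zero ?mulr0.
  suff -> : x i j = 0 by rewrite !mul0r.
  have xt a b : x a b = x b a by rewrite -[in LHS]sx mxE.
  have bE a : basis_sum F i j a 0 != 0 -> a = i \/ a = j.
    rewrite !mxE !eqxx !andbT; case: (eqVneq a i) => [|_]; first by left.
    by case: (eqVneq a j) => [|_]; [right | rewrite addr0 eqxx].
  move: ne; rewrite mulf_eq0 negb_or => /andP [/bE ek /bE em].
  case: ek em => ek [] em; rewrite ?ek ?em ?eqxx // in km xkm *.
  by rewrite xt.
(* Subtracting [x k m] times the square of [basis_sum F k m], whose [(k, m)] entry is 1, reduces to
   [K0]. *)
have off x k m : symmetric_mx x -> k != m -> K x k m = x k m * c k m.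
  move=> sx km; set s := sq_mx (basis_sum F k m).
  have ss : symmetric_mx s by apply: symmetric_sq_mx.
  have s1 : s k m = 1.
    rewrite sq_mxE !mxE !eqxx [m == k]eq_sym (negPf km) /=.
    by rewrite addr0 add0r mulr1.
  have sy : symmetric_mx (x - x k m *: s).
    by apply: symmetric_mxB => //; apply: symmetric_mxZ.
  have -> : K x = K (x - x k m *: s) + x k m *: K s.
    by rewrite -KZ // -KD ?subrK //; apply: symmetric_mxZ.
  have y0 : (x - x k m *: s) k m = 0 by rewrite 3!mxE s1 mulr1 subrr.
  by rewrite mxE K0 // add0r mxE.
pose J : 'M[F]_n := sq_mx (const_mx 1).
have sJ : symmetric_mx J by apply: symmetric_sq_mx.
have J1 i j : J i j = 1 by rewrite sq_mxE !mxE mulr1.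
have [g [b KJ]] := proportional_cols_sq (sK _ sJ) (pK _).
exists g, b^T => x sx; apply/matrixP => i j.
have -> : K x i j = K J i j * x i j.
  have [<-|ij] := eqVneq i j; first by rewrite !Kii // J1 mulr1.
  by rewrite !off // J1 mul1r mulrC.
by rewrite KJ mul_diag_mx mul_mx_diag !mxE big_ord1 !mxE; ring.
Qed.

Lemma det_scaled_congr (F : fieldType) (n : nat) (a : F) (u x : 'M[F]_n) :
  \det (a *: (u *m x *m u^T)) = \det (a *: (u *m u)) * \det x.
Proof. by rewrite !detZ !det_mulmx det_tr; ring. Qed.

(** Writing [K E_ii = l_i w_i w_i^T] and collecting the [w_i] as columns of [W], one gets
    [K 1 = W diag(l) W^T]. Its determinant is 1, so [W] is invertible and undoing the congruence by
    [W] gives the diagonal normal form. *)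
Lemma det_preserver_congr (F : fieldType) (n : nat) (K : 'M[F]_n -> 'M[F]_n) :
  (0 < n)%N -> card_at_least F n.+1 -> (2 : F) != 0 ->
  (forall x, symmetric_mx x -> symmetric_mx (K x)) ->
  (forall x y, symmetric_mx x -> symmetric_mx y -> K (x + y) = K x + K y) ->
  (forall a x, symmetric_mx x -> K (a *: x) = a *: K x) ->
  (forall v, proportional_cols (K (sq_mx v))) ->
  (forall x, symmetric_mx x -> \det (K x) = \det x) ->
  exists u c, \det (c *: (u *m u)) = 1 /\
    forall x, symmetric_mx x -> K x = c *: (u *m x *m u^T).
Proof.
move=> n0 cF two sK KD KZ pK dK.
have ssq (v : 'cV[F]_n) := symmetric_sq_mx v.
(* Boolean equality here lets [xchoose] pick a scalar and a vector for every index. *)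
have ex i : exists cw : F * 'cV[F]_n,
    K (sq_mx (delta_mx i 0)) == cw.1 *: sq_mx cw.2.
  have [c [w ->]] := proportional_cols_sq (sK _ (ssq (delta_mx i 0))) (pK _).
  by exists (c, w).
pose cw i := xchoose (ex i).
have cwE i : K (sq_mx (delta_mx i 0)) = (cw i).1 *: sq_mx (cw i).2.
  by apply/eqP; apply: (xchooseP (ex i)).
pose l : 'rV[F]_n := \row_i (cw i).1.
pose W : 'M[F]_n := \matrix_(k, i) (cw i).2 k 0.
have Wd i : W *m (delta_mx i 0 : 'cV[F]_n) = (cw i).2.
  by rewrite -colE; apply/colP => k; rewrite !mxE.
have WK i : K (sq_mx (delta_mx i 0)) = W *m (l 0 i *: sq_mx (delta_mx i 0)) *m W^T.
  rewrite cwE -scalemxAr -scalemxAl mxE; congr (_ *: _).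
  by rewrite /sq_mx mulmxA Wd -mulmxA -trmx_mul Wd.
have sqd (i : 'I_n) : sq_mx (delta_mx i 0) = delta_mx i i :> 'M[F]_n.
  by rewrite /sq_mx trmx_delta mul_delta_mx.
have K1 : K 1%:M = W *m diag_mx l *m W^T.
  have -> : 1%:M = \sum_i sq_mx (delta_mx i 0) :> 'M[F]_n.
    rewrite -diag_const_mx diag_mx_sum_delta; apply: eq_bigr => i _.
    by rewrite sqd mxE scale1r.
  rewrite (lin_sym_sum KD KZ) // diag_mx_sum_delta mulmx_sumr mulmx_suml.
  by apply: eq_bigr => i _; rewrite WK sqd.
have uW : W \in unitmx.
  have := dK _ (symmetric_mx_scalar n 1); rewrite K1 !det_mulmx det1 => e.
  rewrite unitmxE unitfE; apply/eqP => d0; move: e.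
  by rewrite d0 !mul0r => /eqP; rewrite eq_sym oner_eq0.
pose V := invmx W.
have dV : \det V != 0 by rewrite -unitfE -unitmxE unitmx_inv.
pose K' x := V *m K x *m V^T.
have KK' x : K x = W *m K' x *m W^T.
  by rewrite /K' /V !mulmxA mulmxV // mul1mx -mulmxA -trmx_mul mulmxV // trmx1 mulmx1.
have [|||||||c [b Kb]] :=
    @det_preserver_diag_normal F n K' (\det V * \det V) l n0 cF two.
- by move=> x sx; apply: symmetric_mx_congr; apply: sK.
- by move=> x y sx sy; rewrite /K' KD // mulmxDr mulmxDl.
- by move=> a x sx; rewrite /K' KZ // -scalemxAr -scalemxAl.
- move=> v i k m.
  have [c [w e]] := proportional_cols_sq (sK _ (ssq v)) (pK v).
  have -> : K' (sq_mx v) = c *: sq_mx (V *m w).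
    by rewrite /K' e -scalemxAr -scalemxAl /sq_mx trmx_mul !mulmxA.
  have cE a b : (c *: sq_mx (V *m w)) a b = c * ((V *m w) a 0 * (V *m w) b 0).
    by rewrite mxE sq_mxE.
  by rewrite !cE; ring.
- by rewrite mulf_neq0.
- by move=> x sx; rewrite !det_mulmx det_tr dK //; ring.
- move=> i; rewrite /K' WK !mulmxA mulVmx // mul1mx -mulmxA -trmx_mul mulVmx //.
  by rewrite trmx1 mulmx1.
have KE x : symmetric_mx x -> K x = c *: (W *m diag_mx b *m x *m (W *m diag_mx b)^T).
  move=> sx; rewrite KK' Kb // -scalemxAr -scalemxAl trmx_mul tr_diag_mx.
  by rewrite !mulmxA.
exists (W *m diag_mx b), c; split=> //.
have s1 := symmetric_mx_scalar n (1 : F).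
have := dK _ s1; rewrite KE // det_scaled_congr.
by rewrite det1 mulr1.
Qed.

(** * From the linear part back to the pair of maps *)

Lemma surj_det_pair_normal (F : fieldType) (n : nat) (phi psi : 'M[F]_n -> 'M[F]_n) :
  (0 < n)%N -> card_at_least F n.+1 -> (2 : F) != 0 ->
  (forall x, symmetric_mx x -> symmetric_mx (phi x)) ->
  (forall x, symmetric_mx x -> symmetric_mx (psi x)) ->
  surj_on_sym psi ->
  (forall x y, symmetric_mx x -> symmetric_mx y ->
     \det (phi x + psi y) = \det (x + y)) ->
  exists (x0 : 'M[F]_n) (u : 'M[F]_n) (beta : F),
    [/\ symmetric_mx x0,
        \det (beta *: (u *m u)) = 1,
        (forall x, symmetric_mx x -> phi x = beta *: (u *m (x + x0) *m u^T)) &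
        (forall x, symmetric_mx x -> psi x = beta *: (u *m (x - x0) *m u^T))].
Proof.
move=> n0 cF two sphi spsi surj detE.
have s0 := @symmetric_mx0 F n; have ssq (v : 'cV[F]_n) := symmetric_sq_mx v.
have [K [KE KD KZ]] := det_pair_affine n0 cF two sphi surj detE.
have sK x : symmetric_mx x -> symmetric_mx (K x).
  by move=> sx; rewrite KE //; apply: symmetric_mxB; apply: sphi.
have pK v : proportional_cols (K (sq_mx v)).
  rewrite KE // -[X in phi X](add0r (sq_mx v)).
  exact: (det_pair_step_proportional n0 cF two sphi surj detE).
have dK x : symmetric_mx x -> \det (K x) = \det x.
  (* This choice turns [K z] into [phi z + psi y0], so [det (K z) = det (z + y0)]; it remains to
     show [y0 = 0]. *)
  have [y0 sy0 ey0] : exists2 y0, symmetric_mx y0 & psi y0 = - phi 0.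
    by apply: surj; rewrite -scaleN1r; apply: symmetric_mxZ; apply: sphi.
  have dK0 z : symmetric_mx z -> \det (K z) = \det (z + y0).
    by move=> sz; rewrite KE // -ey0 detE.
  (* Homogeneity of det and linearity of K let us double y0, which forces y0 = 0. *)
  have : y0 = 2 *: y0.
    apply: (det_translation_inj n0 cF two) => //; first exact: symmetric_mxZ.
    move=> z sz; have sz2 : symmetric_mx (2^-1 *: z) by apply: symmetric_mxZ.
    have ez : z = 2 *: (2^-1 *: z) by rewrite scalerA mulfV // scale1r.
    by rewrite -dK0 // {1}ez KZ // detZ dK0 // -detZ scalerDr -ez.
  rewrite scaler_nat mulr2n -[LHS]addr0 => /addrI y00.
  by move=> sx; rewrite dK0 // -y00 addr0.
have [u [c [du Ku]]] := det_preserver_congr n0 cF two sK KD KZ pK dK.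
have [c0 u0] : c != 0 /\ \det u != 0.
  have : \det (c *: (u *m u)) != 0 by rewrite du oner_neq0.
  rewrite detZ det_mulmx !mulf_eq0 !negb_or expf_eq0 n0 /=.
  by case/and3P.
have uu : u \in unitmx by rewrite unitmxE unitfE.
pose T x := c *: (u *m x *m u^T).
have TD x y : T (x + y) = T x + T y by rewrite /T mulmxDr mulmxDl scalerDr.
have Tinv z : symmetric_mx z -> exists2 x, symmetric_mx x & T x = z.
  move=> sz; exists (c^-1 *: (invmx u *m z *m (invmx u)^T)).
    by apply: symmetric_mxZ; apply: symmetric_mx_congr.
  rewrite /T -scalemxAr -scalemxAl scalerA mulfV // scale1r !mulmxA mulmxV //.
  by rewrite mul1mx -mulmxA -trmx_mul mulmxV // trmx1 mulmx1.
have [x0 sx0 ex0] := Tinv _ (sphi _ s0).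
have phiE x : symmetric_mx x -> phi x = T (x + x0).
  by move=> sx; rewrite TD ex0 /T -Ku // KE // subrK.
exists x0, u, c; split=> // y sy; rewrite -/(T _).
(* With [psi y = T z], the hypothesis reads [det (x + x0 + z) = det (x + y)] for all symmetric [x],
   which forces [z + x0 = y]. *)
have [z sz ez] := Tinv _ (spsi _ sy); rewrite -ez; congr T.
apply: (addIr x0); rewrite subrK.
apply: (det_translation_inj n0 cF two) => //; first exact: symmetric_mxD.
move=> x sx; rewrite -(detE x y) // phiE // -ez -TD.
by rewrite /T det_scaled_congr du mul1r [z + _]addrC addrA.
Qed.

Theorem theorem1p1 (F : fieldType) (n : nat) (phi psi : 'M[F]_n -> 'M[F]_n) :
  (0 < n)%N ->
  (2 : F) != 0 ->
  card_at_least F (n ^ 2).+1 ->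
  (forall x, symmetric_mx x -> symmetric_mx (phi x)) ->
  (forall x, symmetric_mx x -> symmetric_mx (psi x)) ->
  (surj_on_sym phi \/ surj_on_sym psi) ->
  (forall x y, symmetric_mx x -> symmetric_mx y ->
     \det (phi x + psi y) = \det (x + y)) ->
  exists (x0 : 'M[F]_n) (u : 'M[F]_n) (beta : F),
    [/\ symmetric_mx x0,
        \det (beta *: (u *m u)) = 1,
        (forall x, symmetric_mx x -> phi x = beta *: (u *m (x + x0) *m u^T)) &
        (forall x, symmetric_mx x -> psi x = beta *: (u *m (x - x0) *m u^T))].
Proof.
move=> n0 two [s [us ss]] sphi spsi surj detE.
(* Since [n <= n^2], there are [n + 1] distinct scalars, enough to test polynomials of degree at
   most [n]. *)
have cF : card_at_least F n.+1.
  exists (take n.+1 s); split; first exact: take_uniq.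
  by rewrite size_takel // ss ltnS -[leqLHS]muln1 leq_mul2l n0 orbT.
case: surj => surj; last exact: (surj_det_pair_normal n0 cF two).
(* When [phi] is the surjective map, the two maps exchange roles, and [x0] changes sign. *)
have [|x0 [u [b [sx0 du h1 h2]]]] :=
    @surj_det_pair_normal F n psi phi n0 cF two spsi sphi surj.
  by move=> x y sx sy; rewrite addrC detE // addrC.
exists (- x0), u, b; split=> //.
- by rewrite -scaleN1r; apply: symmetric_mxZ.
- by move=> x sx; rewrite h1 // opprK.
Qed.
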